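(* Let $k\ge 2$. The map $\eta:\mathsf{riAut}(k)\twoheadrightarrow G_{k,1}$, $\eta(\varphi)=\max(\varphi)$, and its restriction $\mathsf{riAut}_{\mathsf{dict}}(k)\twoheadrightarrow F_{k,1}$ are maximum group homomorphisms.
   Context: Let $A=\{a_1<\dots<a_k\}$ be an ordered alphabet with $k\ge 2$ letters and $A^*$ the free monoid. A right ideal is $R\subseteq A^*$ with $RA^*\subseteq R$; it is essential iff it intersects every (nonempty) right ideal. $\mathsf{riAut}(k)$ is the monoid (under composition of partial functions) of all bijections $\varphi:R_1\to R_2$ between finitely generated essential right ideals with $\varphi(xw)=\varphi(x)w$. $\mathsf{riAut}_{\mathsf{dict}}(k)$ is the submonoid of those $\varphi$ that preserve the dictionary order (prefixes come first; prefix-incomparable words are compared by the first letter where they differ). Every $\varphi\in\mathsf{riAut}(k)$ has a unique maximal extension $\max(\varphi)\in\mathsf{riAut}(k)$. $G_{k,1}=\{\max(\varphi):\varphi\in\mathsf{riAut}(k)\}$ with multiplication $\psi\cdot\varphi=\max(\psi\circ\varphi)$ is a group (the Thompson-Higman group), $F_{k,1}=\{\max(\varphi):\varphi\in\mathsf{riAut}_{\mathsf{dict}}(k)\}$ is a subgroup, and $\eta$ is a surjective homomorphism. A group homomorphism on a semigroup $S$ is a homomorphism from $S$ onto a group. A group homomorphism $h_0:S\twoheadrightarrow G_0$ is maximum iff every group homomorphism $h:S\twoheadrightarrow G$ factors through $h_0$. *)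

(* Defs.v *)
From HB Require Import structures.
From mathcomp Require Import all_boot all_order.
From mathcomp Require Import boolp classical_sets cardinality.
Set Implicit Arguments.
Unset Strict Implicit.
Unset Printing Implicit Defensive.

Import Order.TTheory.
Local Open Scope classical_set_scope.
Local Open Scope group_scope.

(* The alphabet a_1 < ... < a_k is 'I_k with its natural order. *)
Definition word (k : nat) : Type := seq 'I_k.

Definition right_ideal k (R : set (word k)) : Prop :=
  forall x w : word k, R x -> R (x ++ w).

Definition fin_gen k (R : set (word k)) : Prop :=
  exists2 C : set (word k),
    finite_set C & R = [set c ++ w | c in C & w in [set: word k]].

Definition essential k (R : set (word k)) : Prop :=
  forall I : set (word k), right_ideal I -> I !=set0 -> R `&` I !=set0.

Definition fge_right_ideal k (R : set (word k)) : Prop :=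
  [/\ right_ideal R, fin_gen R & essential R].

(* A partial function is represented by its graph, so that equality of partial
   functions (same domain, same values) is equality of graphs. *)
Definition pfun (k : nat) : Type := word k -> word k -> Prop.

Definition pdom k (phi : pfun k) : set (word k) :=
  [set x | exists y, phi x y].
Definition pim k (phi : pfun k) : set (word k) :=
  [set y | exists x, phi x y].

Definition functional k (phi : pfun k) : Prop :=
  forall x y y', phi x y -> phi x y' -> y = y'.
Definition pinjective k (phi : pfun k) : Prop :=
  forall x x' y, phi x y -> phi x' y -> x = x'.

(* phi is a bijection from R_1 = pdom phi onto R_2 = pim phi. *)
Record is_riAut k (phi : pfun k) : Prop := IsRiAut {
  ri_functional : functional phi;
  ri_injective : pinjective phi;
  ri_dom : fge_right_ideal (pdom phi);
  ri_im : fge_right_ideal (pim phi);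
  ri_mul : forall x y w, phi x y -> phi (x ++ w) (y ++ w) }.

Record riAut (k : nat) : Type := RiAut {
  graph :> word k -> word k -> Prop;
  riAutP : is_riAut graph }.

HB.instance Definition _ k := gen_eqMixin (riAut k).
HB.instance Definition _ k := gen_choiceMixin (riAut k).

Lemma riAut_ext k (phi psi : riAut k) :
  (forall x y, phi x y <-> psi x y) -> phi = psi.
Proof.
case: phi => f Hf; case: psi => g Hg /= E.
have e : f = g by apply/funext => x; apply/funext => y; apply/propext.
by case: _ / e Hg => Hg; congr RiAut; apply: Prop_irrelevance.
Qed.

(* A right ideal is finitely generated and essential iff it contains all
   sufficiently long words and a right multiple of every word (the second
   clause only matters when k = 0). *)
Lemma fgeP k (R : set (word k)) : fge_right_ideal R <->
  [/\ right_ideal R, exists N, forall x : word k, N <= size x -> R x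
    & forall x : word k, exists w, R (x ++ w)].
Proof.
split=> [[rR [C finC RE] eR]|[rR [N HN] dR]].
- have dR x : exists w, R (x ++ w).
    have [||y [Ry [w yE]]] := eR [set y | exists w, y = x ++ w].
    + by move=> _ w [u ->]; exists (u ++ w); rewrite catA.
    + by exists x, [::]; rewrite cats0.
    + by exists w; rewrite -yE.
  split=> //; have [s Cs] := (finite_seqP _).1 finC.
  exists (\max_(c <- s) size c) => x xN.
  have [w] := dR x; rewrite {1}RE => -[c cC [v _ E]].
  have cs : c \in s by move: cC; rewrite Cs.
  have le : size c <= size x by apply: leq_trans xN; apply: leq_bigmax_seq.
  have -> : x = c ++ drop (size c) x.
    rewrite -{1}(cat_take_drop (size c) x); congr cat.
    have /(congr1 (take (size c))) := E.
    by rewrite take_size_cat // takel_cat.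
  rewrite RE; exists c => //; by exists (drop (size c) x).
- split=> //.
  + exists [set x | R x /\ size x <= N].
      apply: (@sub_finite_set _ _
        (\bigcup_(n in [set n | n < N.+1]) range (@tval n 'I_k))).
        by move=> x [_ xN]; exists (size x) => //; exists (in_tuple x).
      apply: bigcup_finite; first exact: finite_II.
      by move=> n _; apply: finite_image; apply: finite_finset.
    apply/seteqP; split=> [x Rx|x [c [Rc _]] [w _ <-]]; last exact: rR.
    case: (leqP (size x) N) => xN.
      by exists x => //; exists [::] => //; rewrite cats0.
    exists (take N x); last by exists (drop N x) => //; rewrite cat_take_drop.
    by split; [apply: HN|]; rewrite size_take xN.
  + by move=> I rI [x Ix]; have [w Rw] := dR x; exists (x ++ w); split=> //; apply: rI.
Qed.

Lemma cat_injr (T : eqType) (x y w : seq T) : x ++ w = y ++ w -> x = y.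
Proof.
move=> /(congr1 rev); rewrite !rev_cat => /eqP; rewrite eqseq_cat // eqxx /=.
by move=> /eqP/(congr1 rev); rewrite !revK.
Qed.

Lemma fge_sub k (R R' : set (word k)) :
  R `<=` R' -> right_ideal R' -> fge_right_ideal R -> fge_right_ideal R'.
Proof.
move=> sR rR' /fgeP[rR [N HN] dR]; apply/fgeP; split=> //.
  by exists N => x /HN/sR.
by move=> x; have [w /sR] := dR x; exists w.
Qed.

Lemma fge_dense k (R : set (word k)) (x : word k) :
  fge_right_ideal R -> exists w, R (x ++ w).
Proof. by move=> /fgeP[]. Qed.

Definition pinv k (phi : pfun k) : pfun k := fun x y => phi y x.
(* pcomp psi phi is psi \circ phi, phi being applied first. *)
Definition pcomp k (psi phi : pfun k) : pfun k :=
  fun x z => exists2 y, phi x y & psi y z.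

Lemma pinv_riAut k (phi : pfun k) : is_riAut phi -> is_riAut (pinv phi).
Proof.
move=> [f i d m e]; split=> //.
- by move=> x y y'; apply: i.
- by move=> x y y'; apply: f.
- by move=> x y w; apply: e.
Qed.

Lemma pcomp_dom k (psi phi : pfun k) :
  is_riAut psi -> is_riAut phi -> fge_right_ideal (pdom (pcomp psi phi)).
Proof.
move=> [fs is_ ds ms es] [f i d m e]; apply/fgeP.
have [rd [N HN] dd] := (fgeP _).1 d; have [rds [M HM] dds] := (fgeP _).1 ds.
split.
- move=> x w [z [y xy yz]]; exists (z ++ w), (y ++ w); [exact: e|exact: es].
- exists (N + M) => x xNM.
  have [] := HN (take N x).
    by rewrite size_take; case: ltnP => // _; apply: leq_trans xNM; apply: leq_addr.
  move=> y xy; have /HM[z yz] : M <= size (y ++ drop N x).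
    rewrite size_cat size_drop; apply: leq_trans (leq_addl _ _).
    by rewrite leq_subRL // (leq_trans (leq_addr M N)).
  exists z, (y ++ drop N x) => //; rewrite -{1}(cat_take_drop N x); exact: e.
- move=> x; have [w [y xy]] := dd x; have [v [z yz]] := dds y.
  by exists (w ++ v), z, (y ++ v) => //; rewrite catA; apply: e.
Qed.

Lemma pcomp_riAut k (psi phi : pfun k) :
  is_riAut psi -> is_riAut phi -> is_riAut (pcomp psi phi).
Proof.
move=> Hs Hp; split.
- move=> x z z' [y xy yz] [y' xy' yz'].
  move: yz'; rewrite -(ri_functional Hp xy xy'); exact: (ri_functional Hs yz).
- move=> x x' z [y xy yz] [y' xy' yz'].
  move: xy'; rewrite -(ri_injective Hs yz yz'); exact: (ri_injective Hp xy).
- exact: pcomp_dom.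
- have -> : pim (pcomp psi phi) = pdom (pcomp (pinv phi) (pinv psi)).
    by apply/seteqP; split=> z [x [y xy yz]]; exists x, y.
  by apply: pcomp_dom; apply: pinv_riAut.
- by move=> x z w [y xy yz]; exists (y ++ w); [exact: (ri_mul Hp)|exact: (ri_mul Hs)].
Qed.

Lemma pid_riAut k : is_riAut (fun x y : word k => x = y).
Proof.
have fgeT : fge_right_ideal [set: word k].
  by apply/fgeP; split=> //; [exists 0|move=> x; exists [::]].
split.
- by move=> x y y' <- <-.
- by move=> x y y' -> ->.
- by congr fge_right_ideal: fgeT; apply/seteqP; split=> // x _; exists x.
- by congr fge_right_ideal: fgeT; apply/seteqP; split=> // x _; exists x.
- by move=> x y w ->.
Qed.

Definition riAut_comp k (psi phi : riAut k) : riAut k :=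
  RiAut (pcomp_riAut (riAutP psi) (riAutP phi)).
Definition riAut_id k : riAut k := RiAut (@pid_riAut k).
Definition riAut_inv k (phi : riAut k) : riAut k :=
  RiAut (pinv_riAut (riAutP phi)).

Lemma riAut_compA k : associative (@riAut_comp k).
Proof.
move=> a b c; apply: riAut_ext => x t; split.
  by move=> [z [y xy yz] zt]; exists y => //; exists z.
by move=> [y xy [z yz zt]]; exists z => //; exists y.
Qed.

Lemma riAut_comp1l k : left_id (riAut_id k) (@riAut_comp k).
Proof.
by move=> a; apply: riAut_ext => x y; split=> [[z xz <-]|xy] //; exists y.
Qed.

Lemma riAut_comp1r k : right_id (riAut_id k) (@riAut_comp k).
Proof.
by move=> a; apply: riAut_ext => x y; split=> [[z -> zy]|xy] //; exists x.
Qed.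

HB.instance Definition _ k := isMonoid.Build (riAut k)
  (@riAut_compA k) (@riAut_comp1l k) (@riAut_comp1r k).

Definition extends k (psi phi : riAut k) : Prop :=
  forall x y, phi x y -> psi x y.

Definition is_max_ext k (phi psi : riAut k) : Prop :=
  extends psi phi /\ forall chi : riAut k, extends chi psi -> chi = psi.

Section MaxExt.
Variables (k : nat) (phi : riAut k).

Let mgraph : pfun k := fun x y => forall w,
  pdom phi (x ++ w) \/ pim phi (y ++ w) -> phi (x ++ w) (y ++ w).

Let phi_sub x y : phi x y -> mgraph x y.
Proof. by move=> xy w _; apply: (ri_mul (riAutP phi)). Qed.

Let mgraph_riAut : is_riAut mgraph.
Proof.
have [f i d m e] := riAutP phi.
have mul x y w : mgraph x y -> mgraph (x ++ w) (y ++ w).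
  by move=> xy v; rewrite -!catA; apply: xy.
split=> //.
- move=> x y y' xy xy'; have [w dw] := fge_dense x d.
  have := f _ _ _ (xy w (or_introl dw)) (xy' w (or_introl dw)).
  exact: cat_injr.
- move=> x x' y xy xy'; have [w dw] := fge_dense y m.
  have := i _ _ _ (xy w (or_intror dw)) (xy' w (or_intror dw)).
  exact: cat_injr.
- apply: fge_sub d; first by move=> x [y /phi_sub xy]; exists y.
  by move=> x w [y /mul xy]; exists (y ++ w).
- apply: fge_sub m; first by move=> y [x /phi_sub xy]; exists x.
  by move=> y w [x /mul xy]; exists (x ++ w).
Qed.

Let M : riAut k := RiAut mgraph_riAut.

Let M_greatest (psi : riAut k) : extends psi phi -> extends M psi.
Proof.
move=> s x y xy w [[z xz]|[u uy]].
  by rewrite (ri_functional (riAutP psi) (ri_mul (riAutP psi) w xy) (s _ _ xz)).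
by rewrite (ri_injective (riAutP psi) (ri_mul (riAutP psi) w xy) (s _ _ uy)).
Qed.

Lemma max_ext_exists_unique : exists! psi, is_max_ext phi psi.
Proof.
exists M; split.
  split=> [|chi cM]; first exact: phi_sub.
  apply: riAut_ext => x y; split; last exact: cM.
  by apply: M_greatest => u v uv; apply: cM; apply: phi_sub.
by move=> psi [s mx]; apply: mx; apply: M_greatest.
Qed.

Lemma max_ext_exists : exists psi, is_max_ext phi psi.
Proof. by have [psi []] := max_ext_exists_unique; exists psi. Qed.

Definition max_ext : riAut k := sval (cid max_ext_exists).

Lemma max_extP : is_max_ext phi max_ext.
Proof. exact: svalP (cid max_ext_exists). Qed.

Lemma max_ext_uniq psi : is_max_ext phi psi -> max_ext = psi.
Proof.
have [M' [_ u]] := max_ext_exists_unique.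
by move=> /u <-; rewrite -(u _ max_extP).
Qed.

End MaxExt.

Lemma max_ext_sub k (phi psi : riAut k) :
  extends psi phi -> max_ext phi = max_ext psi.
Proof.
move=> s; apply: max_ext_uniq; have [t mx] := max_extP psi.
by split=> // x y /s/t.
Qed.

Definition in_thompson_G k (psi : riAut k) : bool :=
  `[< exists phi : riAut k, psi = max_ext phi >].

(* G_{k,1} *)
Definition thompson_G (k : nat) : Type := {psi : riAut k | in_thompson_G psi}.

HB.instance Definition _ k := [isSub of thompson_G k for sval].
HB.instance Definition _ k := [Choice of thompson_G k by <:].

Lemma eta_subproof k (phi : riAut k) : in_thompson_G (max_ext phi).
Proof. by apply/asboolP; exists phi. Qed.

Definition eta k (phi : riAut k) : thompson_G k := Sub _ (eta_subproof phi).

Definition thompson_mul k (psi phi : thompson_G k) : thompson_G k :=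
  eta (val psi * val phi).
Definition thompson_one k : thompson_G k := eta 1.
Definition thompson_inv k (phi : thompson_G k) : thompson_G k :=
  eta (riAut_inv (val phi)).

Lemma eta_eq k (phi psi : riAut k) : extends psi phi -> eta phi = eta psi.
Proof. by move=> s; apply: val_inj; apply: max_ext_sub. Qed.

Lemma eta_val k (g : thompson_G k) : eta (val g) = g.
Proof.
apply: val_inj; case: g => psi /= /asboolP[phi ->].
by apply/esym/max_ext_sub; have [] := max_extP phi.
Qed.

Lemma etaM k (psi phi : riAut k) :
  eta (psi * phi) = thompson_mul (eta psi) (eta phi).
Proof.
apply: eta_eq => x z [y xy yz].
by exists y; [apply: (max_extP phi).1|apply: (max_extP psi).1].
Qed.

Lemma etaV k (phi : riAut k) : eta (riAut_inv phi) = thompson_inv (eta phi).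
Proof. by apply: eta_eq => x y xy; apply: (max_extP phi).1. Qed.

Lemma thompson_mulA k : associative (@thompson_mul k).
Proof.
move=> a b c; rewrite -(eta_val a) -(eta_val b) -(eta_val c).
by rewrite -!etaM mulgA.
Qed.

Lemma thompson_mul1l k : left_id (thompson_one k) (@thompson_mul k).
Proof. by move=> a; rewrite -(eta_val a) -etaM mul1g. Qed.

Lemma thompson_mul1r k : right_id (thompson_one k) (@thompson_mul k).
Proof. by move=> a; rewrite -(eta_val a) -etaM mulg1. Qed.

Lemma thompson_mulVl k :
  left_inverse (thompson_one k) (@thompson_inv k) (@thompson_mul k).
Proof.
move=> a; rewrite -(eta_val a) -etaV -etaM; apply: eta_eq => x z [y xy zy].
exact: (ri_injective (riAutP (val a)) xy zy).
Qed.

Lemma thompson_mulVr k :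
  right_inverse (thompson_one k) (@thompson_inv k) (@thompson_mul k).
Proof.
move=> a; rewrite -(eta_val a) -etaV -etaM; apply: eta_eq => x z [y yx yz].
exact: (ri_functional (riAutP (val a)) yx yz).
Qed.

HB.instance Definition _ k := isGroup.Build (thompson_G k)
  (@thompson_mulA k) (@thompson_mul1l k) (@thompson_mul1r k)
  (@thompson_mulVl k) (@thompson_mulVr k).

(* The dictionary order is the order of [seqlexi], in which a prefix precedes
   its extensions. *)
Definition dict_le k (x y : word k) : bool :=
  ((x : seqlexi 'I_k) <= (y : seqlexi 'I_k))%O.

Definition dict_preserving k (phi : riAut k) : bool :=
  `[< forall x1 y1 x2 y2, phi x1 y1 -> phi x2 y2 ->
        dict_le x1 x2 -> dict_le y1 y2 >].

Definition riAut_dict (k : nat) : Type :=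
  {phi : riAut k | dict_preserving phi}.

HB.instance Definition _ k := [isSub of riAut_dict k for sval].
HB.instance Definition _ k := [Choice of riAut_dict k by <:].

Lemma dict_closed k : monoid_closed (@dict_preserving k).
Proof.
split=> [|psi phi /asboolP Hs /asboolP Hp]; apply/asboolP.
  by move=> x1 y1 x2 y2 <- <-.
move=> x1 z1 x2 z2 [y1 xy1 yz1] [y2 xy2 yz2] /(Hp _ _ _ _ xy1 xy2).
exact: Hs.
Qed.

HB.instance Definition _ k := SubChoice_isSubMonoid.Build
  (riAut k) (@dict_preserving k) (riAut_dict k) (@dict_closed k).

Lemma dict_inv k (phi : riAut k) :
  dict_preserving phi -> dict_preserving (riAut_inv phi).
Proof.
move=> /asboolP H; apply/asboolP => y1 x1 y2 x2 xy1 xy2 le_y.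
rewrite /dict_le; case/orP: (le_total (x1 : seqlexi 'I_k) x2) => // le_x.
have ge_y := H _ _ _ _ xy2 xy1 le_x.
have e : y1 = y2 by apply: (@le_anti _ (seqlexi 'I_k)); apply/andP; split.
by move: xy2; rewrite -e => /(ri_injective (riAutP phi) xy1) ->.
Qed.

Definition in_thompson_F k (g : thompson_G k) : bool :=
  `[< exists phi : riAut_dict k, g = eta (val phi) >].

(* F_{k,1} *)
Definition thompson_F (k : nat) : Type := {g : thompson_G k | in_thompson_F g}.

HB.instance Definition _ k := [isSub of thompson_F k for sval].
HB.instance Definition _ k := [Choice of thompson_F k by <:].

Lemma F_closed k : group_closed (@in_thompson_F k).
Proof.
split=> [|_ _ /asboolP[phi ->] /asboolP[psi ->]]; apply/asboolP.
  by exists 1.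
exists (phi * Sub (riAut_inv (val psi)) (dict_inv (valP psi))).
by have /= -> := etaM (val phi) (riAut_inv (val psi)); rewrite etaV.
Qed.

HB.instance Definition _ k := SubChoice_isSubGroup.Build
  (thompson_G k) (@in_thompson_F k) (thompson_F k) (@F_closed k).

Lemma eta_dict_subproof k (phi : riAut_dict k) : in_thompson_F (eta (val phi)).
Proof. by apply/asboolP; exists phi. Qed.

Definition eta_dict k (phi : riAut_dict k) : thompson_F k :=
  Sub _ (eta_dict_subproof phi).

Definition group_hom (S : semigroupType) (G : groupType) (h : S -> G) : Prop :=
  {morph h : x y / x * y} /\ (forall g : G, exists x : S, h x = g).

(* [groupType] carries a choice structure; under the classical axioms every
   group has one, so G below ranges over all groups. *)
Definition maximum_group_hom (S : semigroupType) (G0 : groupType)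
    (h0 : S -> G0) : Prop :=
  group_hom h0 /\
  forall (G : groupType) (h : S -> G), group_hom h ->
    exists2 f : G0 -> G, {morph f : x y / x * y} & h = f \o h0.

(* Main.v *)
(** If [max phi = max psi], then [phi] and [psi] agree on the intersection of
    their domains, so [phi * e = psi * e] for the partial identity [e] on that
    intersection. Since [e] is idempotent, every homomorphism onto a group maps
    it to [1], hence identifies [phi] and [psi]. *)

Require Import Defs.
From mathcomp Require Import all_boot.
From mathcomp Require Import boolp.
Set Implicit Arguments.
Unset Strict Implicit.
Unset Printing Implicit Defensive.

Local Open Scope group_scope.

Lemma morph_idempotent (S : semigroupType) (G : groupType) (h : S -> G) e :
  {morph h : x y / x * y} -> e * e = e -> h e = 1.
Proof. by move=> hM ee; apply: (mulgI (h e)); rewrite -hM ee mulg1. Qed.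

(** Any [h] onto a group sends the idempotent [e] to [1], so [x * e = y * e] forces [h x = h y];
    hence [h] is constant on the fibres of [h0]. *)
Lemma maximum_group_hom_idempotent (S : semigroupType) (G0 : groupType)
    (h0 : S -> G0) :
  group_hom h0 ->
  (forall x y, h0 x = h0 y -> exists2 e, e * e = e & x * e = y * e) ->
  maximum_group_hom h0.
Proof.
move=> h0_hom h0_ker; split=> // G h [hM _]; have [h0M h0_surj] := h0_hom.
have h_eq x y : h0 x = h0 y -> h x = h y.
  move=> /h0_ker[e ee xye].
  by move: (congr1 h xye); rewrite !hM (morph_idempotent hM ee) !mulg1.
(* A section of [h0], not necessarily multiplicative; [h \o s] is, since [s (g1 * g2)] and
   [s g1 * s g2] lie in one fibre of [h0]. *)
pose s g := sval (cid (h0_surj g)).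
have sK g : h0 (s g) = g by apply: (svalP (cid (h0_surj g))).
exists (h \o s) => [g1 g2 /=|]; first by rewrite -hM; apply: h_eq; rewrite h0M !sK.
by apply/funext => x; apply: h_eq; rewrite sK.
Qed.

(** The partial identity on the common domain, written as a product so that closure under
    composition and inverse puts it in [riAut k]. *)
Definition riAut_dom_id k (phi psi : riAut k) : riAut k :=
  (riAut_inv phi * phi) * (riAut_inv psi * psi).

Lemma riAut_dom_idE k (phi psi : riAut k) x y :
  riAut_dom_id phi psi x y <-> [/\ x = y, pdom phi x & pdom psi x].
Proof.
split=> [[u [v xv uv] [t ut yt]]|[<- [u xu] [v xv]]].
  have xu := ri_injective (riAutP psi) xv uv.
  have uy := ri_injective (riAutP phi) ut yt.
  by rewrite -uy -xu in ut *; split; [|exists t|exists v].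
by exists x; [exists v|exists u].
Qed.

Lemma riAut_dom_id_idempotent k (phi psi : riAut k) :
  riAut_dom_id phi psi * riAut_dom_id phi psi = riAut_dom_id phi psi.
Proof.
apply: riAut_ext => x z; split=> [[y /riAut_dom_idE[<- _ _]] //|xz].
by exists x => //; apply/riAut_dom_idE; case/riAut_dom_idE: xz.
Qed.

(** The right factor acts first, so it restricts both maps to the common domain, where they agree as
    restrictions of one maximal extension. *)
Lemma eta_eq_dom_id k (phi psi : riAut k) : eta phi = eta psi ->
  phi * riAut_dom_id phi psi = psi * riAut_dom_id phi psi.
Proof.
move=> /(congr1 val) /= eq_max.
have agree x y z : phi x y -> psi x z -> y = z.
  move=> /(max_extP phi).1; rewrite eq_max => xy /(max_extP psi).1.
  exact: (ri_functional (riAutP (max_ext psi)) xy).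
apply: riAut_ext => x z; split=> -[y xy yz]; exists y => //;
  case/riAut_dom_idE: xy => [<-{y} [u xu] [v xv]] in yz *.
- by rewrite (agree _ _ _ yz xv).
- by rewrite -(agree _ _ _ xu yz).
Qed.

(** This places the idempotent in [riAut_dict k], so the same argument serves [eta_dict]. *)
Lemma riAut_dom_id_dict k (phi psi : riAut k) :
  dict_preserving (riAut_dom_id phi psi).
Proof.
apply/asboolP => x1 y1 x2 y2.
by move=> /riAut_dom_idE[<- _ _] /riAut_dom_idE[<- _ _].
Qed.

Lemma eta_group_hom k : group_hom (@eta k).
Proof. by split=> [|g]; [exact: etaM|exists (val g); exact: eta_val]. Qed.

Lemma eta_dict_group_hom k : group_hom (@eta_dict k).
Proof.
split=> [phi psi|[g Fg]]; first by apply: val_inj; apply: etaM.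
by have /asboolP[phi gE] := Fg; exists phi; apply: val_inj.
Qed.

Theorem proposition2p8 (k : nat) (hk : 2 <= k) :
  maximum_group_hom (@eta k) /\ maximum_group_hom (@eta_dict k).
Proof.
split; apply: maximum_group_hom_idempotent.
- exact: eta_group_hom.
- move=> phi psi /eta_eq_dom_id; exists (riAut_dom_id phi psi) => //.
  exact: riAut_dom_id_idempotent.
- exact: eta_dict_group_hom.
- move=> phi psi /(congr1 val) /eta_eq_dom_id eqe.
  exists (Sub _ (riAut_dom_id_dict (val phi) (val psi))); apply: val_inj => //.
  exact: riAut_dom_id_idempotent.
Qed.
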